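(* For any integers $n \ge 1$ and $0 \leq k \leq n-1$, the number of standard monomials of $M_n^{(k)}$ is \[|\operatorname{stan}_n^k| = \sum_{j=0}^{k} \binom{n}{j} (k+1-j)(k+1)^{j-1}(n-k)^{n-j}.\]
   Context: Fix a field $\mathbb{K}$ and let $S = \mathbb{K}[x_1,\dots,x_n]$, $[n]=\{1,\dots,n\}$. For nonempty $\sigma \subseteq [n]$ let $m_\sigma = \prod_{i\in\sigma} x_i^{\,n-|\sigma|+1}$. For $0 \le k \le n-1$ let $M_n^{(k)} = \langle m_\sigma : \sigma \subseteq [n],\ 1 \le |\sigma| \le k+1\rangle \subset S$. The standard monomials of a monomial ideal are the monomials of $S$ not lying in the ideal; $\operatorname{stan}_n^k$ denotes the set of standard monomials of $M_n^{(k)}$. In the formula, $(k+1)^{j-1}$ for $j=0$ means the rational number $1/(k+1)$. *)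

(* Defs.v *)
From HB Require Import structures.
From mathcomp Require Import all_boot all_order all_algebra.
From mathcomp Require Import mpoly.

Set Implicit Arguments.
Unset Strict Implicit.
Unset Printing Implicit Defensive.

Import GRing.Theory.
Local Open Scope ring_scope.

(* The ideal of R generated by the finite family (g i), i ranging over P. *)
Definition ideal_gen (R : comNzRingType) (I : finType) (P : pred I)
    (g : I -> R) (p : R) : Prop :=
  exists c : I -> R, p = \sum_(i | P i) c i * g i.

(* The variables x_1, ..., x_n are indexed by 'I_n. The subtraction is never
   truncated, since #|s| <= n. *)
Definition m_sigma (K : fieldType) (n : nat) (s : {set 'I_n}) : {mpoly K[n]} :=
  \prod_(i in s) 'X_i ^+ (n - #|s| + 1).

Definition M_ideal (K : fieldType) (n k : nat) : {mpoly K[n]} -> Prop :=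
  ideal_gen (fun s : {set 'I_n} => (1 <= #|s| <= k + 1)%N) (@m_sigma K n).

Definition is_monomial (K : fieldType) (n : nat) (p : {mpoly K[n]}) : Prop :=
  exists m : 'X_{1..n}, p = 'X_[m].

Definition standard_monomial (K : fieldType) (n : nat)
    (J : {mpoly K[n]} -> Prop) (p : {mpoly K[n]}) : Prop :=
  is_monomial p /\ ~ J p.

Definition stan (K : fieldType) (n k : nat) : {mpoly K[n]} -> Prop :=
  standard_monomial (@M_ideal K n k).

(* A is finite with exactly N elements. *)
Definition has_card (T : eqType) (A : T -> Prop) (N : nat) : Prop :=
  exists s : seq T, [/\ uniq s, forall x, x \in s <-> A x & size s = N].

(* Main.v *)
(* A monomial x^a is standard iff a has at most t entries >= n - t for every
   t <= k; t = 0 gives a_i < n, so b_i = n - 1 - a_i turns this into the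
   truncated parking condition #{i | b_i < t} <= t for all t <= k. The entries
   b_i >= k are free, with n - k choices each. The functions with values below k
   on a j-set, subject to the condition, number (k + 1 - j) (k + 1)^(j - 1):
   removing the entries equal to k - 1 expresses this number as the sum of the
   numbers for k - 1 over all subsets, and the formula follows by induction on k
   from the binomial theorem. *)
Require Import Defs.
From mathcomp Require Import all_boot all_order all_algebra.
From mathcomp Require Import mpoly zify ring.

Set Implicit Arguments.
Unset Strict Implicit.
Unset Printing Implicit Defensive.

Import Order.TTheory GRing.Theory Num.Theory.
Local Open Scope ring_scope.

(** * Sums over subsets and a binomial identity *)

Lemma sum_subsets (R : comNzRingType) (T : finType) (A : {set T})
    (g : nat -> R) :
  \sum_(B : {set T} | B \subset A) g #|B| =
  \sum_(i < #|A|.+1) 'C(#|A|, i)%:R * g i.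
Proof.
rewrite (partition_big (fun B : {set T} => inord #|B| : 'I_#|A|.+1) xpredT) //=.
apply: eq_bigr => i _.
transitivity (\sum_(B in [set B : {set T} | B \subset A & #|B| == i]) g i).
  apply: eq_big => [B|B].
    rewrite !inE; case sBA: (B \subset A) => //=.
    by rewrite -val_eqE /= inordK // ltnS subset_leq_card.
  case/andP=> sBA /eqP <-.
  by rewrite inordK // ltnS subset_leq_card.
by rewrite sumr_const cards_draws mulr_natl.
Qed.

Lemma card_subset_of_size (T : finType) (A : {set T}) (m : nat) :
  (m <= #|A|)%N -> exists2 B : {set T}, B \subset A & #|B| = m.
Proof.
rewrite -bin_gt0 -cards_draws => /card_gt0P[B].
by rewrite inE => /andP[sBA /eqP szB]; exists B.
Qed.

(** Each summand is a binomial coefficient times x^i - i x^(i-1), so the sum is (x + 1)^a minus its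
    derivative a (x + 1)^(a-1). *)
Lemma binomial_parking_sum (F : numFieldType) (a : nat) (x : F) :
  0 < x ->
  \sum_(i < a.+1) 'C(a, i)%:R * ((x - i%:R) * x ^+ i / x) =
  (x + 1 - a%:R) * (x + 1) ^+ a / (x + 1).
Proof.
move=> x0; have nx : x != 0 by rewrite gt_eqF.
have nx1 : x + 1 != 0 by rewrite gt_eqF ?addr_gt0.
case: a => [|a].
  by rewrite big_ord1 bin0 !expr0 !subr0 !mulr1 !divff ?mulr1.
transitivity (\sum_(i < a.+2) 'C(a.+1, i)%:R * x ^+ i
   - \sum_(i < a.+2) i%:R * 'C(a.+1, i)%:R * x ^+ i / x).
  by rewrite -sumrB; apply: eq_bigr => i _; field.
have -> : \sum_(i < a.+2) 'C(a.+1, i)%:R * x ^+ i = (x + 1) ^+ a.+1.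
  by rewrite addrC exprDn; apply: eq_bigr => i _; rewrite expr1n mul1r mulr_natl.
rewrite big_ord_recl !mul0r add0r.
have -> : \sum_(i < a.+1) (lift ord0 i)%:R * 'C(a.+1, lift ord0 i)%:R
     * x ^+ lift ord0 i / x = a.+1%:R * (x + 1) ^+ a.
  rewrite addrC exprDn mulr_sumr; apply: eq_bigr => i _.
  rewrite /= /bump /= add1n -natrM -mul_bin_diag natrM expr1n mul1r exprS -mulr_natl.
  by field.
by rewrite exprS; field.
Qed.

(** * Counting parking functions *)

(* A function on T is the same as its restrictions to A and to ~: A, each
   extended by the constant d. *)
Lemma card_extend_off (T C : finType) (A : {set T}) (P : pred {ffun T -> C})
    (D : T -> pred C) (d : C) :
  (forall f g : {ffun T -> C}, {in A, f =1 g} -> P f = P g) ->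
  #|[set f | P f & [forall i in ~: A, f i \in D i]]| =
  (#|[set f | P f & [forall i in ~: A, f i == d]]| *
   #|pfamily d (mem (~: A)) D|)%N.
Proof.
move=> PA.
pose on (f : {ffun T -> C}) := [ffun i => if i \in A then f i else d].
pose off (f : {ffun T -> C}) := [ffun i => if i \in A then d else f i].
pose glue (u : {ffun T -> C} * {ffun T -> C}) :=
  [ffun i => if i \in A then u.1 i else u.2 i].
have glueK : cancel (fun f => (on f, off f)) glue.
  by move=> f; apply/ffunP=> i; rewrite !ffunE /=; case: (i \in A).
rewrite -(card_imset _ (can_inj glueK)) -[X in (_ * X)%N]cardsE -cardsX.
apply: eq_card => -[f1 f2]; rewrite !inE /=.
apply/imsetP/idP => [[f]|].
  rewrite inE => /andP[Pf /forall_inP fD] [-> ->].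
  apply/andP; split.
    rewrite (PA _ f) => [|i iA]; last by rewrite ffunE iA.
    rewrite Pf; apply/forall_inP => i; rewrite inE => /negbTE iA.
    by rewrite ffunE iA.
  apply/forallP => i; rewrite !inE ffunE.
  by case: (boolP (i \in A)) => [iA|iA] /=; [rewrite inE | apply: fD; rewrite inE].
case/andP => /andP[Pf1 /forall_inP f1d] /forallP f2D.
exists (glue (f1, f2)).
  rewrite inE (PA _ f1) => [|i iA]; last by rewrite ffunE iA.
  rewrite Pf1; apply/forall_inP => i; rewrite inE => iA.
  by have := f2D i; rewrite !inE iA ffunE (negbTE iA).
congr (_, _); apply/ffunP => i; rewrite !ffunE; case: (boolP (i \in A)) => // iA.
  by apply/eqP; apply: f1d; rewrite inE.
by have := f2D i; rewrite !inE iA /= => /eqP.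
Qed.

(** Reflected by c -> t - 1 - c, the restriction of [f] to [A] is a parking function of [#|A|] cars
    on t spots: for every s, at most s cars prefer one of the last s spots. *)
Definition parking (T : finType) (n : nat) (A : {set T}) (t : nat)
    (f : {ffun T -> 'I_n}) : bool :=
  [forall i in A, f i < t]%N &&
  [forall s : 'I_t.+1, #|[set i in A | f i < s]%N| <= s]%N.

(* Outside A the functions are frozen at ord0, so that functions on the varying
   subsets A share one type. *)
Definition parking_count (T : finType) (n : nat) (A : {set T}) (t : nat) :
    nat :=
  #|[set f : {ffun T -> 'I_n.+1} |
      parking A t f & [forall i in ~: A, f i == ord0]]|.

Lemma parking_eq_in (T : finType) (n : nat) (A : {set T}) (t : nat)
    (f g : {ffun T -> 'I_n}) :
  {in A, f =1 g} -> parking A t f = parking A t g.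
Proof.
move=> fg; congr (_ && _).
  by apply: eq_forallb_in => i iA; rewrite fg.
apply: eq_forallb => s; congr (#|pred_of_set _| <= _)%N.
by apply/setP => i; rewrite !inE; case: (boolP (i \in A)) => // iA; rewrite fg.
Qed.

(** All values on [A] are below t, so the condition at s = t bounds [#|A|] itself. *)
Lemma parking_count_gt (T : finType) (n : nat) (A : {set T}) (t : nat) :
  (t < #|A|)%N -> parking_count n A t = 0%N.
Proof.
move=> tA; apply: eq_card0 => f; rewrite !inE; apply/negP.
case/andP => /andP[/forall_inP ft /forallP/(_ ord_max) /=].
have -> : [set i in A | f i < t]%N = A; last by rewrite leqNgt tA.
by apply/setP => i; rewrite inE; case: (boolP (i \in A)) => // iA; rewrite ft.
Qed.

(** The functions are sorted by the set [B] of points of [A] with value below t; on the rest of [A]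
    the value is t. The bounds for s <= t only see [B], and the one for s = t + 1 follows from the
    hypothesis on [#|A|]. *)
Lemma parking_countS (T : finType) (n : nat) (A : {set T}) (t : nat) :
  (t < n.+1)%N -> (#|A| <= t.+1)%N ->
  parking_count n A t.+1 =
  (\sum_(B : {set T} | B \subset A) parking_count n B t)%N.
Proof.
move=> tn At.
rewrite /parking_count -sum1_card.
rewrite (partition_big (fun f : {ffun T -> 'I_n.+1} => [set i in A | f i < t]%N)
  (fun B : {set T} => B \subset A)) /=; last first.
  by move=> f _; apply/subsetP => i; rewrite inE => /andP[].
apply: eq_bigr => B sBA; rewrite sum1dep_card.
pose D (i : T) : pred 'I_n.+1 :=
  if i \in A then pred1 (Ordinal tn) else pred1 ord0.
transitivity #|[set f : {ffun T -> 'I_n.+1} |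
    parking B t f & [forall i in ~: B, f i \in D i]]|; last first.
  rewrite (card_extend_off D ord0) => [|f g]; last exact: parking_eq_in.
  rewrite card_pfamily [X in (_ * X)%N](_ : _ = 1%N) ?muln1 //.
  rewrite /image_mem; elim: (enum_mem _) => //= i s ->; rewrite muln1 /D.
  by case: ifP => _; rewrite card1.
apply: eq_card => f; rewrite !inE; apply/idP/idP.
  case/andP => /andP[/andP[/forall_inP fA /forallP fs] /forall_inP f0] /eqP eB.
  have inB i : (i \in B) = (i \in A) && (f i < t)%N by rewrite -eB inE.
  apply/andP; split; last first.
    apply/forall_inP => i; rewrite !inE inB /D; case: ifP => [iA /= fi|/negbT iA _].
      by have := fA i iA; rewrite inE -val_eqE /= => ?; lia.
    by rewrite inE f0 // inE iA.
  apply/andP; split; first by apply/forall_inP => i; rewrite inB => /andP[].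
  apply/forallP => s; have /= := fs (widen_ord (leqnSn _) s).
  apply: leq_trans; apply: subset_leq_card; apply/subsetP => i.
  by rewrite !inE => /andP[/(subsetP sBA) -> ->].
case/andP => /andP[/forall_inP fB /forallP fs] /forall_inP fD.
have fAB i : i \in A -> i \notin B -> f i = t :> nat.
  by move=> iA iB; have := fD i; rewrite inE iB /D iA inE => /(_ isT)/eqP ->.
have eB : [set i in A | f i < t]%N = B.
  apply/setP => i; rewrite inE; case: (boolP (i \in B)) => iB.
    by rewrite (subsetP sBA) ?fB.
  by case: (boolP (i \in A)) => // iA /=; rewrite fAB // ltnn.
rewrite eB eqxx andbT; apply/andP; split; last first.
  apply/forall_inP => i; rewrite inE => iA; have := fD i.
  rewrite inE /D (negbTE iA) inE; apply.
  by apply: contra iA; apply: (subsetP sBA).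
apply/andP; split.
  apply/forall_inP => i iA; case: (boolP (i \in B)) => iB.
    by apply: ltnW; rewrite ltnS fB.
  by rewrite fAB.
apply/forallP => s; case: (ltnP s t.+1) => st.
  apply: leq_trans (fs (Ordinal st)); apply: subset_leq_card.
  apply/subsetP => i; rewrite !inE /= => /andP[iA fi]; rewrite fi andbT.
  by apply: contraLR fi => iB; rewrite fAB // -leqNgt -ltnS.
apply: leq_trans st; apply: leq_trans At; apply: subset_leq_card.
by apply/subsetP => i; rewrite inE => /andP[].
Qed.

(** Induction on t through [parking_countS]. The bound on t makes every value below t available in
    ['I_n.+1], and the truncated difference makes the right side 0 when [#|A|] exceeds t. *)
Lemma parking_countE (F : numFieldType) (T : finType) (n t : nat) (A : {set T}) :
  (t <= n.+1)%N ->
  (parking_count n A t)%:R =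
  (t.+1 - #|A|)%:R * t.+1%:R ^+ #|A| / t.+1%:R :> F.
Proof.
elim: t A => [|t IHt] A tn.
  rewrite expr1n divr1 mulr1; have [A0|A0] := posnP #|A|; last first.
    by rewrite parking_count_gt //; congr (_%:R); lia.
  congr (_%:R); rewrite A0; apply/eqP/cards1P; exists [ffun=> ord0].
  move/cards0_eq: A0 => ->; apply/setP => f; rewrite !inE; apply/idP/eqP.
    case/andP => _ /forall_inP f0; apply/ffunP => i; rewrite ffunE.
    by apply/eqP/f0; rewrite !inE.
  move=> ->; apply/andP; split; last by apply/forall_inP => i _; rewrite ffunE.
  apply/andP; split; first by apply/forall_inP => i; rewrite inE.
  apply/forallP => s; rewrite (_ : [set _ in _ | _] = set0) ?cards0 //.
  by apply/setP => i; rewrite !inE.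
have [At|At] := leqP #|A| t.+1; last first.
  rewrite parking_count_gt // (_ : (_ - _ = 0)%N) ?mul0r //; lia.
rewrite parking_countS // natr_sum.
under eq_bigr => B _ do rewrite IHt 1?ltnW //.
rewrite (sum_subsets A (fun i => (t.+1 - i)%:R * t.+1%:R ^+ i / t.+1%:R)).
under eq_bigr => i _ do rewrite natrB ?(leq_trans (leq_ord i) At) //.
(* The identity is applied at x = t + 1. *)
rewrite binomial_parking_sum ?ltr0n // natrB; last exact: leqW.
by rewrite -[t.+2]addn1 natrD.
Qed.

(** The functions are sorted by the set [B] where the value is below k. As s <= k, the bounds
    constrain only the values on [B]; each of the others is any of k, ..., n. *)
Lemma card_truncated_parking (n k : nat) :
  (k <= n.+1)%N ->
  #|[set f : {ffun 'I_n.+1 -> 'I_n.+1} |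
      [forall s : 'I_k.+1, #|[set i | f i < s]%N| <= s]%N]| =
  (\sum_(B : {set 'I_n.+1}) parking_count n B k * (n.+1 - k) ^ (n.+1 - #|B|))%N.
Proof.
move=> kn.
rewrite -sum1_card (partition_big (fun f : {ffun 'I_n.+1 -> 'I_n.+1} =>
  [set i | f i < k]%N) xpredT) //=.
apply: eq_bigr => B _; rewrite sum1dep_card.
pose D : pred 'I_n.+1 := fun c => (k <= c)%N.
transitivity #|[set f : {ffun 'I_n.+1 -> 'I_n.+1} |
    parking B k f & [forall i in ~: B, f i \in D]]|; last first.
  rewrite (card_extend_off (fun=> D) ord0) => [|f g]; last exact: parking_eq_in.
  rewrite card_pffun_on (cardsCs (~: B)) setCK card_ord.
  congr (_ * _ ^ _)%N.
  by rewrite -sum1_card -(big_geq_mkord k n.+1 xpredT (fun=> 1%N)) sum_nat_const_nat muln1.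
apply: eq_card => f; rewrite !inE; apply/idP/idP.
  case/andP => /forallP fs /eqP eB.
  have inB i : (i \in B) = (f i < k)%N by rewrite -eB inE.
  apply/andP; split; last first.
    by apply/forall_inP => i; rewrite inE inB -leqNgt.
  apply/andP; split; first by apply/forall_inP => i; rewrite inB.
  apply/forallP => s; apply: leq_trans (fs s); apply: subset_leq_card.
  by apply/subsetP => i; rewrite !inE => /andP[].
case/andP => /andP[/forall_inP fB /forallP fs] /forall_inP fD.
have inB i : (i \in B) = (f i < k)%N.
  case: (boolP (i \in B)) => iB; first by rewrite fB.
  by have := fD i; rewrite inE iB => /(_ isT); rewrite /in_mem /= /D ltnNge => ->.
apply/andP; split; last by apply/eqP/setP => i; rewrite inE inB.
apply/forallP => s; apply: leq_trans (fs s); apply: subset_leq_card.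
apply/subsetP => i; rewrite !inE inB => fi; rewrite fi andbT.
by apply: leq_trans fi _; rewrite -ltnS.
Qed.

(** * Monomial ideals and their standard monomials *)

Lemma mpolyX_inj (n : nat) (R : nzRingType) :
  injective (fun m : 'X_{1..n} => 'X_[m] : {mpoly R[n]}).
Proof.
move=> m1 m2 /(congr1 (mcoeff m2)); rewrite !mcoeffX eqxx.
by case: eqP => // _ /esym/eqP; rewrite oner_eq0.
Qed.

(** If no generator divided the monomial, every term of the combination would have coefficient 0 at
    [m], since the support of a multiple of ['X_[u i]] lies above [u i]. *)
Lemma ideal_gen_mpolyX (n : nat) (R : comNzRingType) (I : finType) (P : pred I)
    (u : I -> 'X_{1..n}) (m : 'X_{1..n}) :
  ideal_gen P (fun i => 'X_[u i] : {mpoly R[n]}) 'X_[m] <->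
  exists2 i, P i & (u i <= m)%MM.
Proof.
split=> [[c mE]|[i Pi uim]].
  have [/existsP[i /andP[Pi um]]|/existsPn noI] :=
    boolP [exists i, P i && (u i <= m)%MM]; first by exists i.
  have /eqP := congr1 (mcoeff m) mE; rewrite mcoeffX eqxx raddf_sum /= big1 ?oner_eq0 //.
  move=> i Pi; apply: memN_msupp_eq0.
  rewrite (perm_mem (msuppMX _ _)); apply/mapP => -[m' _ em].
  by have := noI i; rewrite Pi em lem_addr.
exists (fun j => if j == i then 'X_[m - u i] else 0).
rewrite (bigD1 i) //= eqxx -mpolyXD submK // big1 ?addr0 // => j /andP[_ /negbTE ->].
by rewrite mul0r.
Qed.

Definition mnm_sigma (n : nat) (s : {set 'I_n}) : 'X_{1..n} :=
  [multinom if i \in s then n - #|s| + 1 else 0 | i < n]%N.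

Lemma m_sigmaE (K : fieldType) (n : nat) (s : {set 'I_n}) :
  m_sigma K s = 'X_[mnm_sigma s].
Proof.
rewrite mpolyXE_id /m_sigma big_mkcond /=; apply: eq_bigr => i _.
by rewrite mnmE; case: ifP => _; rewrite ?expr0.
Qed.

(** For a set of size t + 1 the exponent in [m_sigma] is n - t, so such a generator divides the
    monomial exactly when t + 1 entries of [m] are at least n - t. *)
Lemma M_ideal_mpolyX (K : fieldType) (n k : nat) (m : 'X_{1..n}) :
  (k < n)%N ->
  ~ @M_ideal K n k 'X_[m] <->
  forall t, (t <= k)%N -> (#|[set i | n - t <= m i]| <= t)%N.
Proof.
move=> kn.
have -> : @M_ideal K n k 'X_[m] <-> exists2 s : {set 'I_n},
    (1 <= #|s| <= k + 1)%N & (mnm_sigma s <= m)%MM.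
  rewrite -(@ideal_gen_mpolyX n K).
  by split=> -[c ->]; exists c; apply: eq_bigr => s _; rewrite m_sigmaE.
split=> [noS t tk|small [s sz /mnm_lepP sm]].
  rewrite leqNgt; apply/negP => /card_subset_of_size[s /subsetP sm sz].
  apply: noS; exists s; first by rewrite sz; lia.
  apply/mnm_lepP => i; rewrite mnmE; case: ifP => // /sm; rewrite inE sz; lia.
(* The bound at t = [#|s|.-1] is violated, because [s] lies in the set it bounds. *)
have s1k : (#|s|.-1 <= k)%N by lia.
suff /subset_leq_card /leq_trans/(_ (small _ s1k)) :
  s \subset [set i | n - #|s|.-1 <= m i]%N by lia.
apply/subsetP => i si; rewrite inE; have := sm i; rewrite mnmE si.
have := max_card (mem s); rewrite card_ord; lia.
Qed.

Lemma stan_has_card (K : fieldType) (n k : nat) :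
  (k <= n)%N ->
  has_card (@stan K n.+1 k)
    #|[set f : {ffun 'I_n.+1 -> 'I_n.+1} |
        [forall s : 'I_k.+1, #|[set i | f i < s]%N| <= s]%N]|.
Proof.
move=> kn; set S := [set f | _].
pose mon (f : {ffun 'I_n.+1 -> 'I_n.+1}) : 'X_{1..n.+1} :=
  [multinom (n - f i)%N | i < n.+1].
have mon_inj : injective mon.
  move=> f g fg; apply/ffunP => i; apply/val_inj => /=.
  have := congr1 (fun m : 'X_{1..n.+1} => m i) fg; rewrite !mnmE.
  have := ltn_ord (f i); have := ltn_ord (g i); lia.
have monE f t : (t <= n)%N ->
  [set i | n.+1 - t <= mon f i]%N = [set i | f i < t]%N.
  by move=> tn; apply/setP => i; rewrite !inE mnmE; have := ltn_ord (f i); lia.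
exists [seq 'X_[mon f] | f <- enum S]; split.
- by rewrite map_inj_uniq ?enum_uniq // => f g /mpolyX_inj/mon_inj.
- move=> p; split=> [/mapP[f] | [[m ->]]].
    rewrite mem_enum inE => /forallP fs ->; split; first by exists (mon f).
    apply/M_ideal_mpolyX => // t tk; rewrite monE ?(leq_trans tk) //.
    by rewrite -ltnS in tk; have := fs (Ordinal tk).
  move/M_ideal_mpolyX => /(_ kn) ms.
  (* The bound at t = 0 keeps the exponents at most n, so that n - m i inverts [mon] without
     truncation. *)
  have mn i : (m i <= n)%N.
    have := ms 0%N isT; rewrite subn0 leqn0 cards_eq0 => /eqP/setP/(_ i).
    by rewrite !inE; lia.
  pose f := [ffun i : 'I_n.+1 => inord (n - m i) : 'I_n.+1].
  have mE : mon f = m.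
    by apply/mnmP => i; rewrite mnmE ffunE inordK ?ltnS ?leq_subr // subKn.
  rewrite -mE; apply: map_f; rewrite mem_enum inE; apply/forallP => s.
  have sk : (s <= k)%N by rewrite -ltnS.
  by rewrite -monE ?(leq_trans sk) // mE ms.
- by rewrite size_map -cardE.
Qed.

(* (k + 1)^(j - 1) is an integer power in rat, so it is 1 / (k + 1) at j = 0;
   k + 1 - j and n - k are non-truncated differences as j <= k < n. *)
Theorem corollary2p2 (K : fieldType) (n k : nat) (hn : (1 <= n)%N)
    (hk : (0 <= k <= n - 1)%N) :
  exists N : nat,
    has_card (@stan K n k) N /\
    (N%:R : rat) =
      \sum_(0 <= j < k.+1)
        'C(n, j)%:R * (k + 1 - j)%:R * (k + 1)%:R ^ (j%:Z - 1)
          * (n - k)%:R ^+ (n - j).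
Proof.
case: n hn hk => // n _; rewrite subn1 /= => kn.
eexists; split; first exact: stan_has_card.
rewrite card_truncated_parking ?(leq_trans kn) // natr_sum.
under eq_bigr => B _ do rewrite natrM natrX parking_countE ?(leqW kn) //.
under eq_bigl => B do rewrite -[true](subsetT B).
rewrite (sum_subsets setT (fun i => (k.+1 - i)%:R * k.+1%:R ^+ i / k.+1%:R *
  (n.+1 - k)%:R ^+ (n.+1 - i))) cardsT card_ord.
rewrite -(big_mkord xpredT (fun i => 'C(n.+1, i)%:R * ((k.+1 - i)%:R *
  k.+1%:R ^+ i / k.+1%:R * (n.+1 - k)%:R ^+ (n.+1 - i)))).
(* Sizes above k contribute nothing, as the truncated difference k + 1 - j vanishes there. *)
rewrite (@big_cat_nat _ _ _ k.+1) //=; last by rewrite ltnW // !ltnS.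
rewrite [X in _ + X]big_nat_cond [X in _ + X]big1 ?addr0 => [|i /andP[/andP[ki _] _]].
  apply: eq_bigr => j _; rewrite addn1 expfzDr ?pnatr_eq0 // exprN1 -exprnP.
  by rewrite !mulrA.
by rewrite (_ : (k.+1 - i = 0)%N) ?mul0r ?mulr0 //; apply/eqP; rewrite subn_eq0.
Qed.
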